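(* Let $K$ be a (not necessarily commutative) field that is a subfield of a ring $R$ with $1$, with $1_K=1_R$, and let $\Sigma(K,R)=(\mathbb{P}(R),\mathfrak{C}(K,R))$ be the chain geometry over $(K,R)$. Let $$N:=N_{R^*}(K^* )=\{n\in R^*\mid n^{-1}Kn=K\}$$ be the normalizer of $K^*$ in $R^*$. Then for each triple of pairwise distant points of $\Sigma(K,R)$, the set of chains through that triple is in $1$-$1$-correspondence with the set $$R^*/N:=\{Nr\mid r\in R^*\}$$ of right cosets of $N$ in $R^*$. In particular, in $\Sigma(K,R)$ there exists exactly one chain through each triple of pairwise distant points if, and only if, $K^*$ is normal in $R^*$.
   Context: $R$ is an associative ring with $1$, and $R^*$ denotes its group of units; ''field'' means not necessarily commutative field (division ring). $R$ is not assumed to be a $K$-algebra, i.e. $K$ need not be central in $R$. $\Gamma:=\mathrm{GL}_2(R)$ is the group of invertible $2\times 2$-matrices over $R$, acting from the right on the free left $R$-module $R^2$ (row vectors). The point set is the projective line over $R$, $\mathbb{P}(R):=R(1,0)^\Gamma=\{R(a,b)\mid \exists c,d\in R:\begin{pmatrix}a&b\\c&d\end{pmatrix}\in\Gamma\}$, the orbit of the submodule $R(1,0)$ under $\Gamma$. The projective line $\mathbb{P}(K)$ over $K$ is embedded into $\mathbb{P}(R)$ via $K(k,l)\mapsto R(k,l)$; its image $\mathcal{C}$ is called the standard chain. The chain set is the orbit $\mathfrak{C}(K,R):=\mathcal{C}^\Gamma$, and its elements are called chains. The chain geometry over $(K,R)$ is $\Sigma(K,R)=(\mathbb{P}(R),\mathfrak{C}(K,R))$,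 with incidence being membership. Points $R(a,b)$, $R(c,d)$ of $\mathbb{P}(R)$ are distant if $\begin{pmatrix}a&b\\c&d\end{pmatrix}\in\mathrm{GL}_2(R)$ (this does not depend on the choice of the generators $(a,b)$, $(c,d)$). *)

(* Defs.v *)
From HB Require Import structures.
From mathcomp Require Import all_boot all_order all_algebra.
From mathcomp Require Import all_classical.

Set Implicit Arguments.
Unset Strict Implicit.
Unset Printing Implicit Defensive.

Import GRing.Theory.

Local Open Scope classical_set_scope.
Local Open Scope ring_scope.

Section ChainGeometry.
Variable R : unitRingType.

(* Subrings S of R containing 1 are handled as subsets of R, so that the
   same definitions, at S := [set: R] and S := K, serve for R and for K. *)
Implicit Types (S K : set R) (p q r : set 'rV[R]_2).

Definition is_subfield K : Prop :=
  [/\ K 1,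
      forall x y, K x -> K y -> K (x - y),
      forall x y, K x -> K y -> K (x * y) &
      forall x, K x -> x != 0 -> x \is a GRing.unit /\ K x^-1].

Definition units S : set R :=
  [set x | [/\ x \is a GRing.unit, S x & S x^-1]].

Definition conj_set (n : R) (A : set R) : set R :=
  [set n^-1 * x * n | x in A].

Definition normalizer K : set R :=
  [set n | units [set: R] n /\ conj_set n K = K].

Definition normal_in (H G : set R) : Prop :=
  H `<=` G /\ forall g, G g -> conj_set g H = H.

Definition right_cosets (N G : set R) : set (set R) :=
  [set [set n * r | n in N] | r in G].

Definition mx_over S (m n : nat) (A : 'M[R]_(m, n)) : Prop :=
  forall i j, S (A i j).

(* MathComp's [unitmx] needs a commutative ring. *)
Definition GL2 S : set 'M[R]_2 :=
  [set g | mx_over S g /\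
     exists h, [/\ mx_over S h, g *m h = 1%:M & h *m g = 1%:M]].

Definition cyclic_submod S (v : 'rV[R]_2) : set 'rV[R]_2 :=
  [set x *: v | x in S].

Definition act_point p (g : 'M[R]_2) : set 'rV[R]_2 :=
  [set v *m g | v in p].

Definition proj_line S : set (set 'rV[R]_2) :=
  [set act_point (cyclic_submod S (delta_mx 0 0)) g | g in GL2 S].

(* Existential over the generators: if R is not Dedekind-finite, a point R(a,b)
   can also have generators that are not a row of any invertible matrix. *)
Definition distant p q : Prop :=
  exists u v : 'rV[R]_2,
    [/\ p = cyclic_submod [set: R] u, q = cyclic_submod [set: R] v &
        GL2 [set: R] (col_mx u v)].

Definition distant_triple p q r : Prop :=
  [/\ proj_line [set: R] p, proj_line [set: R] q & proj_line [set: R] r] /\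
  [/\ distant p q, distant p r & distant q r].

(* Image of the projective line over K under K(k,l) |-> R(k,l). *)
Definition standard_chain K : set (set 'rV[R]_2) :=
  [set cyclic_submod [set: R] v |
     v in [set v : 'rV[R]_2 | mx_over K v /\ proj_line K (cyclic_submod K v)]].

Definition chains K : set (set (set 'rV[R]_2)) :=
  [set [set act_point p g | p in standard_chain K] | g in GL2 [set: R]].

Definition chains_through K p q r : set (set (set 'rV[R]_2)) :=
  [set D | chains K D /\ [/\ D p, D q & D r]].

End ChainGeometry.

(* Main.v *)
Require Import Defs.
From mathcomp Require Import all_boot all_order all_algebra.
From mathcomp Require Import all_classical.

(** Write C for the standard chain, p0 = R(1,0), q0 = R(0,1), r0 = R(1,1), and
    X^g for the image of a point or of a chain X under a matrix g.

    The group GL_2(R) is transitive on triples of pairwise distant points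
    ([distant_triple_frame]): if R u, R v, R w are pairwise distant, then u, v
    is a basis and w = a u + b v, where distance of w from u and from v forces
    b and a to be units ([third_row_unit]); the matrix with rows a u, b v then
    sends p0, q0, r0 to R u, R v, R w. So a triple is (p0, q0, r0)^f for some
    f, and the chains through it are the D^f with D a chain through p0, q0, r0.

    Suppose that C^g contains p0, q0, r0, as images of three points of C.
    These are pairwise distant too, and the argument above can be
    repeated with all vectors over K, because a matrix over K that is
    invertible over R has its inverse over K ([subfield_reflects_GL2]). This
    yields k in GL_2(K) such that k g fixes p0, q0 and r0, whence k g is a
    scalar matrix s I with s a unit ([fix_triple_scalar]). Since C is the
    orbit of p0 under GL_2(K) ([standard_chain_orbit]), C^k = C, and hence
    C^g = C^(s I). So the chains through (p0, q0, r0)^f are exactly the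
    C^(s I f), s in R^* ([chains_through_frame]).

    The matrix s I sends R(1,k) to R(1, s^-1 k s), and from this C^(s I) = C
    if and only if s normalizes K ([standard_chain_scalar]). Therefore
    C^(s I f) = C^(t I f) if and only if s t^-1 is in N, and sending a chain D
    to the set of all s with C^(s I f) = D is a bijection from the chains
    through the triple onto the right cosets of N ([chains_through_card]).
    There is one chain through each triple exactly when N = R^*, which is
    normality of K^* in R^*. *)

Local Open Scope classical_set_scope.
Local Open Scope ring_scope.

Section ChainsThroughATriple.

Set Implicit Arguments.
Unset Strict Implicit.
Import GRing.Theory.

Variable R : unitRingType.
Implicit Types (S K : set R) (u v w : 'rV[R]_2) (g h : 'M[R]_2).
Implicit Types (p q r : set 'rV[R]_2) (D : set (set 'rV[R]_2)) (a b c s t : R).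

(** * Invertible matrices over a subring *)

(** The ring and its subfield are treated alike: the linear algebra below is
    used both for S = R and for S = K. *)
Definition is_subring S : Prop :=
  [/\ S 1, forall x y, S x -> S y -> S (x - y) &
      forall x y, S x -> S y -> S (x * y)].

Lemma subring_setT : is_subring [set: R].
Proof. by []. Qed.

Lemma subring0 S : is_subring S -> S 0.
Proof. by case=> S1 SB _; rewrite -(subrr 1); apply: SB. Qed.

Lemma subringN S x : is_subring S -> S x -> S (- x).
Proof.
by move=> hS Sx; case: (hS) => _ SB _; rewrite -sub0r; apply: SB => //;
  apply: subring0.
Qed.

Lemma subringD S x y : is_subring S -> S x -> S y -> S (x + y).
Proof.
move=> hS Sx Sy; case: (hS) => _ SB _; rewrite -[y]opprK; apply: SB => //.
exact: subringN.
Qed.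

Lemma mx_overM S m n k (A : 'M[R]_(m, n)) (B : 'M[R]_(n, k)) :
  is_subring S -> mx_over S A -> mx_over S B -> mx_over S (A *m B).
Proof.
move=> hS SA SB i j; rewrite mxE; elim/big_ind: _ => [|x y Sx Sy|l _].
- exact: subring0.
- exact: subringD.
- by case: hS => _ _ SM; apply: SM.
Qed.

Lemma mx_over_scalar S n a : is_subring S -> S a -> mx_over S (a%:M : 'M[R]_n).
Proof.
by move=> hS Sa i j; rewrite mxE; case: eqP => _ //=; rewrite ?mulr0n //;
  apply: subring0.
Qed.

Lemma mx_over_col_mx S u v :
  mx_over S u -> mx_over S v -> mx_over S (col_mx u v).
Proof. by move=> Su Sv i j; rewrite mxE; case: (fintype.split i) => k. Qed.

Lemma mx_overZ S a m n (A : 'M[R]_(m, n)) :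
  is_subring S -> S a -> mx_over S A -> mx_over S (a *: A).
Proof. by case=> _ _ SM Sa SA i j; rewrite mxE; apply: SM. Qed.

Lemma GL2_1 S : is_subring S -> GL2 S 1%:M.
Proof.
move=> hS; have h1 : mx_over S (1%:M : 'M[R]_2).
  by apply: mx_over_scalar => //; case: hS.
by split=> //; exists 1%:M; rewrite mulmx1.
Qed.

Lemma GL2M S g h : is_subring S -> GL2 S g -> GL2 S h -> GL2 S (g *m h).
Proof.
move=> hS [Sg [g' [Sg' gg' g'g]]] [Sh [h' [Sh' hh' h'h]]].
split; first exact: mx_overM.
exists (h' *m g'); split; first exact: mx_overM.
- by rewrite mulmxA -(mulmxA g) hh' mulmx1.
- by rewrite mulmxA -(mulmxA h') g'g mulmx1.
Qed.

Lemma GL2_inv S g : GL2 S g ->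
  exists h, [/\ GL2 S h, g *m h = 1%:M & h *m g = 1%:M].
Proof.
by move=> [Sg [h [Sh gh hg]]]; exists h; split=> //; split=> //;
  exists g.
Qed.

Lemma GL2_setT S g : GL2 S g -> GL2 [set: R] g.
Proof. by move=> [_ [h [_ gh hg]]]; split=> //; exists h. Qed.

Lemma GL2_scalar S a : is_subring S -> units S a -> GL2 S a%:M.
Proof.
move=> hS [ua Sa SaV]; split; first exact: mx_over_scalar.
exists a^-1%:M; split; first exact: mx_over_scalar.
- by rewrite -scalar_mxM divrr.
- by rewrite -scalar_mxM mulVr.
Qed.

(** * Bases of the left module of rows *)

Definition e0 : 'rV[R]_2 := delta_mx 0 0.
Definition e1 : 'rV[R]_2 := delta_mx 0 1.

Lemma row2_col_mx (x : 'rV[R]_2) u v :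
  x *m (col_mx u v : 'M[R]_2) = x 0 0 *: u + x 0 1 *: v.
Proof.
rewrite -[x in LHS](@hsubmxK R 1 1 1) (@mul_row_col R 1 1 1 2).
rewrite [lsubmx _]mx11_scalar [rsubmx _]mx11_scalar !mul_scalar_mx !mxE.
by congr (x _ _ *: _ + x _ _ *: _); apply/val_inj.
Qed.

Lemma rV2E (x : 'rV[R]_2) : x = x 0 0 *: e0 + x 0 1 *: e1.
Proof.
apply/rowP=> i; rewrite !mxE; case: (unliftP 0 i) => [j|] -> /=.
  by rewrite (ord1 j) mulr0 add0r mulr1; congr (x _ _); apply/val_inj.
by rewrite mulr1 mulr0 addr0.
Qed.

Lemma e0_entries : (e0 0 0 = 1) * (e0 0 1 = 0).
Proof. by rewrite !mxE. Qed.

Lemma e1_entries : (e1 0 0 = 0) * (e1 0 1 = 1).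
Proof. by rewrite !mxE. Qed.

Lemma e0_col_mx u v : e0 *m (col_mx u v : 'M[R]_2) = u.
Proof. by rewrite row2_col_mx !e0_entries scale1r scale0r addr0. Qed.

Lemma e1_col_mx u v : e1 *m (col_mx u v : 'M[R]_2) = v.
Proof. by rewrite row2_col_mx !e1_entries scale1r scale0r add0r. Qed.

Definition row_col_mx := (e0_col_mx, e1_col_mx).

Lemma col_mx_row2 g : (col_mx (e0 *m g) (e1 *m g) : 'M[R]_2) = g.
Proof.
have E : (col_mx e0 e1 : 'M[R]_2) = 1%:M.
  apply/row_matrixP => i; rewrite !rowE mulmx1 row2_col_mx -rV2E //.
by rewrite -(@mul_col_mx R 1 1 2 2) E mul1mx.
Qed.

(** Matrix identities are proved by comparing rows, since rows of products of
    [col_mx] matrices are computed by [row_col_mx]. *)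
Lemma mx_eq_e0e1 g h : e0 *m g = e0 *m h -> e1 *m g = e1 *m h -> g = h.
Proof. by move=> E0 E1; rewrite -(col_mx_row2 g) -(col_mx_row2 h) E0 E1. Qed.

Lemma mx_over_e0 S : is_subring S -> mx_over S e0.
Proof.
by move=> hS i j; rewrite mxE; case: (_ && _); [case: hS | apply: subring0].
Qed.

Lemma mx_over_e1 S : is_subring S -> mx_over S e1.
Proof.
by move=> hS i j; rewrite mxE; case: (_ && _); [case: hS | apply: subring0].
Qed.

Lemma mx_over_lincomb S a b u v : is_subring S -> S a -> S b ->
  mx_over S u -> mx_over S v -> mx_over S (a *: u + b *: v).
Proof.
move=> hS Sa Sb Su Sv i j; rewrite !mxE; case: (hS) => _ _ SM.
by apply: subringD => //; apply: SM.
Qed.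

Lemma GL2_col_mx_inj u v a b c s : GL2 [set: R] (col_mx u v) ->
  a *: u + b *: v = c *: u + s *: v -> a = c /\ b = s.
Proof.
move=> [_ [h [_ gh _]]] E.
have F x y : (x *: e0 + y *: e1) *m (col_mx u v : 'M[R]_2) = x *: u + y *: v.
  by rewrite mulmxDl -!scalemxAl e0_col_mx e1_col_mx.
have := congr1 (fun w => w *m h) E; rewrite -!F -!mulmxA gh !mulmx1.
move=> /rowP H; move: (H 0) (H 1);
  rewrite !mxE /= !(mulr0, mulr1, addr0, add0r).
by [].
Qed.

Lemma GL2_col_mx_span S u v w : is_subring S -> GL2 S (col_mx u v) ->
  mx_over S w -> exists a b, [/\ S a, S b & w = a *: u + b *: v].
Proof.
move=> hS [_ [h [Sh _ hg]]] Sw;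
  have Swh : mx_over S (w *m h) by apply: mx_overM.
exists ((w *m h) 0 0), ((w *m h) 0 1); split=> //.
by rewrite -row2_col_mx -mulmxA hg mulmx1.
Qed.

Lemma swap_invol : (col_mx e1 e0 : 'M[R]_2) *m (col_mx e1 e0 : 'M[R]_2) = 1%:M.
Proof.
by apply: mx_eq_e0e1; rewrite mulmxA !row_col_mx mulmx1.
Qed.

Lemma GL2_swap S : is_subring S -> GL2 S (col_mx e1 e0).
Proof.
move=> hS; have Ss : mx_over S (col_mx e1 e0).
  by apply: mx_over_col_mx; [apply: mx_over_e1 | apply: mx_over_e0].
by split=> //; exists (col_mx e1 e0); rewrite swap_invol.
Qed.

Lemma GL2_col_mxC S u v : is_subring S ->
  GL2 S (col_mx u v) -> GL2 S (col_mx v u).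
Proof.
move=> hS G; have := GL2M hS (GL2_swap hS) G.
rewrite (_ : col_mx e1 e0 *m _ = col_mx v u) //.
by apply: mx_eq_e0e1; rewrite mulmxA !row_col_mx.
Qed.

Lemma diag_col_mx a b u v :
  (col_mx (a *: e0) (b *: e1) : 'M[R]_2) *m (col_mx u v : 'M[R]_2) =
  col_mx (a *: u) (b *: v).
Proof.
by apply: mx_eq_e0e1;
  rewrite mulmxA !row_col_mx -scalemxAl row_col_mx.
Qed.

Lemma col_mx_e0e1 : (col_mx e0 e1 : 'M[R]_2) = 1%:M.
Proof. by apply: mx_eq_e0e1; rewrite row_col_mx mulmx1. Qed.

Lemma GL2_scale_rows S u v a b : is_subring S -> units S a -> units S b ->
  GL2 S (col_mx u v) -> GL2 S (col_mx (a *: u) (b *: v)).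
Proof.
move=> hS [ua Sa SaV] [ub Sb SbV] G.
have Sd c s : S c -> S s -> mx_over S (col_mx (c *: e0) (s *: e1)).
  move=> Sc Ss; apply: mx_over_col_mx; apply: mx_overZ => //.
    exact: mx_over_e0.
  exact: mx_over_e1.
rewrite -diag_col_mx //; apply: GL2M => //; split; first exact: Sd.
exists (col_mx (a^-1 *: e0) (b^-1 *: e1)); split; first exact: Sd.
- by rewrite diag_col_mx !scalerA !divrr // !scale1r col_mx_e0e1.
- by rewrite diag_col_mx !scalerA !mulVr // !scale1r col_mx_e0e1.
Qed.

Lemma GL2_add_row S u v k : is_subring S -> S k ->
  GL2 S (col_mx u v) -> GL2 S (col_mx u (k *: u + v)).
Proof.
move=> hS Sk G; rewrite -[col_mx _ _](_ :
  (col_mx e0 (k *: e0 + e1) : 'M[R]_2) *m col_mx u v = _).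
  have Sm c : S c -> mx_over S (col_mx e0 (c *: e0 + e1)).
    move=> Sc; apply: mx_over_col_mx; first exact: mx_over_e0.
    rewrite -[e1]scale1r; apply: mx_over_lincomb => //.
    - by case: hS.
    - exact: mx_over_e0.
    - exact: mx_over_e1.
  apply: GL2M => //; split; first exact: Sm.
  exists (col_mx e0 (- k *: e0 + e1)); split.
  - by apply: Sm; apply: subringN.
  - apply: mx_eq_e0e1;
      rewrite mulmxA !row_col_mx ?mulmxDl -?scalemxAl ?row_col_mx mulmx1 //.
    by rewrite scaleNr addrA addrN add0r.
  - apply: mx_eq_e0e1;
      rewrite mulmxA !row_col_mx ?mulmxDl -?scalemxAl ?row_col_mx mulmx1 //.
    by rewrite scaleNr addKr.
by apply: mx_eq_e0e1;
  rewrite mulmxA !row_col_mx ?mulmxDl -?scalemxAl ?row_col_mx.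
Qed.

Lemma GL2_sum_row u v : GL2 [set: R] (col_mx u v) ->
  GL2 [set: R] (col_mx u (u + v)).
Proof.
by move=> G; have := GL2_add_row (k := 1) subring_setT I G;
  rewrite scale1r.
Qed.

(** * Points and the distant relation *)

Definition point v : set 'rV[R]_2 := cyclic_submod [set: R] v.

(** Two generators of one submodule need not differ by a unit when R is not
    Dedekind-finite; they do if both are cancellable ([point_eq]). Rows of
    invertible matrices are cancellable. *)
Definition cancellable v : Prop := forall x, x *: v = 0 -> x = 0.

Lemma act_cyclic_submod S v g :
  act_point (cyclic_submod S v) g = cyclic_submod S (v *m g).
Proof.
rewrite /act_point /cyclic_submod image_comp; apply: eq_imagel => x _ /=.
by rewrite scalemxAl.
Qed.

Lemma act_pointE v g : act_point (point v) g = point (v *m g).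
Proof. exact: act_cyclic_submod. Qed.

Lemma act_pointM p g h : act_point (act_point p g) h = act_point p (g *m h).
Proof.
by rewrite /act_point image_comp; apply: eq_imagel => v _ /=;
  rewrite mulmxA.
Qed.

Lemma act_point1 p : act_point p 1%:M = p.
Proof.
rewrite /act_point -[RHS]image_id; apply: eq_imagel => v _ /=.
by rewrite mulmx1.
Qed.

Lemma scaler_inj_cancellable v a b : cancellable v -> a *: v = b *: v -> a = b.
Proof.
move=> hv E; apply/eqP; rewrite -subr_eq0; apply/eqP; apply: hv.
by rewrite scalerBl E subrr.
Qed.

Lemma cyclic_submod_id S v : S 1 -> cyclic_submod S v v.
Proof. by move=> S1; exists 1; rewrite ?scale1r. Qed.

Lemma point_eq u v : cancellable u -> cancellable v -> point u = point v ->
  exists a, units [set: R] a /\ v = a *: u.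
Proof.
move=> hu hv E.
have [a _ va] : point u v by rewrite E; apply: cyclic_submod_id.
have [b _ ub] : point v u by rewrite -E; apply: cyclic_submod_id.
have ba : b * a = 1.
  by apply: (scaler_inj_cancellable hu); rewrite -scalerA va ub scale1r.
have ab : a * b = 1.
  by apply: (scaler_inj_cancellable hv); rewrite -scalerA ub va scale1r.
exists a; rewrite va; split=> //; split=> //.
by apply/unitrP; exists b.
Qed.

Lemma point_scale a u : units [set: R] a -> point (a *: u) = point u.
Proof.
move=> [ua _ _]; apply/seteqP; split=> [w [x _ <-]|w [x _ <-]].
  by exists (x * a) => //; rewrite scalerA.
by exists (x * a^-1) => //; rewrite scalerA mulrVK.
Qed.

Lemma cancellable_GL2 S u v : GL2 S (col_mx u v) ->
  cancellable u /\ cancellable v.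
Proof.
move=> /GL2_setT G; split=> x E.
  by apply: (GL2_col_mx_inj (b := 0) (c := 0) (s := 0) G _).1;
    rewrite E !scale0r.
by apply: (GL2_col_mx_inj (a := 0) (c := 0) (s := 0) G _).2; rewrite E !scale0r.
Qed.

Lemma row_mul_GL2_inj g u v : GL2 [set: R] g -> u *m g = v *m g -> u = v.
Proof.
by move=> [_ [h [_ gh _]]] /(congr1 (fun w => w *m h));
  rewrite -!mulmxA gh !mulmx1.
Qed.

Lemma cancellable_e0 : cancellable e0.
Proof. by move=> x /rowP/(_ 0); rewrite !mxE mulr1. Qed.

Lemma cancellable_mul v g :
  GL2 [set: R] g -> cancellable v -> cancellable (v *m g).
Proof.
move=> G hv x; rewrite scalemxAl => E; apply: hv.
by apply: (row_mul_GL2_inj G); rewrite mul0mx.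
Qed.

(** Distance is defined by some pair of generators; here it is transferred to
    any given cancellable generators. *)
Lemma distant_GL2 u v : cancellable u -> cancellable v ->
  distant (point u) (point v) -> GL2 [set: R] (col_mx u v).
Proof.
move=> hu hv [u' [v' [Eu Ev G]]]; have [hu' hv'] := cancellable_GL2 G.
have [a [ua ->]] := point_eq hu' hu (esym Eu).
have [b [ub ->]] := point_eq hv' hv (esym Ev).
exact: GL2_scale_rows.
Qed.

Lemma distant_act p q g : GL2 [set: R] g -> distant p q ->
  distant (act_point p g) (act_point q g).
Proof.
move=> G [u [v [-> -> H]]]; exists (u *m g), (v *m g).
rewrite !act_cyclic_submod -(@mul_col_mx R 1 1 2 2); split=> //.
exact: GL2M.
Qed.

(** Since u, w is a basis, v = x u + y w. Substituting this and
    w = a u + b v into each other and comparing coefficients gives y b = 1 from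
    the basis u, v, and b y = 1 from the basis u, w. *)
Lemma third_row_unit u v w a b :
  GL2 [set: R] (col_mx u v) -> GL2 [set: R] (col_mx u w) ->
  w = a *: u + b *: v -> units [set: R] b.
Proof.
move=> Guv Guw Ew.
have [x [y [_ _ Ev]]] := GL2_col_mx_span subring_setT Guw
  (fun _ _ => I : [set: R] (v _ _)).
have [_ yb] : x + y * a = 0 /\ y * b = 1.
  apply: (GL2_col_mx_inj Guv); rewrite scale0r scale1r add0r {2}Ev Ew.
  by rewrite scalerDr !scalerA scalerDl addrA.
have [_ b_y] : a + b * x = 0 /\ b * y = 1.
  apply: (GL2_col_mx_inj Guw); rewrite scale0r scale1r add0r {2}Ew Ev.
  by rewrite scalerDr !scalerA scalerDl addrA.
by split=> //; apply/unitrP; exists y.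
Qed.

Definition p0 := point e0.
Definition q0 := point e1.
Definition r0 := point (e0 + e1).

(** Holds for S = R trivially, and for S = K by [subfield_reflects_GL2]; it
    makes one transitivity argument serve for both. *)
Definition reflects_GL2 S : Prop :=
  forall g, mx_over S g -> GL2 [set: R] g -> GL2 S g.

(** The matrix with rows a u, b v, where w = a u + b v: the coefficients a, b
    are units, and they lie in S because the inverse of (u ; v) is over S. *)
Lemma distant_rows_frame S u v w : is_subring S -> reflects_GL2 S ->
  mx_over S u -> mx_over S v -> mx_over S w ->
  GL2 [set: R] (col_mx u v) -> GL2 [set: R] (col_mx u w) ->
  GL2 [set: R] (col_mx v w) ->
  exists g, [/\ GL2 S g, act_point p0 g = point u, act_point q0 g = point v &
    act_point r0 g = point w].
Proof.
move=> hS rS Su Sv Sw Guv Guw Gvw.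
have GSuv : GL2 S (col_mx u v) by apply: rS => //; apply: mx_over_col_mx.
have [a [b [Sa Sb Ew]]] := GL2_col_mx_span hS GSuv Sw.
have ub := third_row_unit Guv Guw Ew.
have ua : units [set: R] a.
  apply: (third_row_unit (u := v) (v := u) (w := w) (a := b)) => //.
    exact: GL2_col_mxC.
  by rewrite addrC.
exists (col_mx (a *: u) (b *: v)); split.
- apply: rS; last exact: GL2_scale_rows.
  by apply: mx_over_col_mx; apply: mx_overZ.
- by rewrite act_pointE row_col_mx point_scale.
- by rewrite act_pointE row_col_mx [LHS]point_scale.
- by rewrite act_pointE mulmxDl !row_col_mx -Ew.
Qed.

Lemma proj_line_row p : proj_line [set: R] p ->
  exists2 u, cancellable u & p = point u.
Proof.
move=> [g G <-]; exists (e0 *m g); last by rewrite act_pointE.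
by apply: cancellable_mul => //; apply: cancellable_e0.
Qed.

Lemma distant_triple_frame p q r : distant_triple p q r ->
  exists g, [/\ GL2 [set: R] g, act_point p0 g = p, act_point q0 g = q &
    act_point r0 g = r].
Proof.
case=> -[/proj_line_row[u hu ->] /proj_line_row[v hv ->]].
move=> /proj_line_row[w hw ->] [puv puw pvw].
by apply: distant_rows_frame; rewrite //; apply: distant_GL2.
Qed.

Lemma std_distant_triple : distant_triple p0 q0 r0.
Proof.
have G01 : GL2 [set: R] (col_mx e0 e1) by rewrite col_mx_e0e1; apply: GL2_1.
have G10 := GL2_col_mxC subring_setT G01.
have G02 := GL2_sum_row G01.
have G12 : GL2 [set: R] (col_mx e1 (e0 + e1)).
  by rewrite addrC; apply: GL2_sum_row.
split; split.
- by exists (col_mx e0 e1); rewrite // -/e0 act_pointE row_col_mx.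
- by exists (col_mx e1 e0); rewrite // -/e0 act_pointE row_col_mx.
- exists (col_mx (e0 + e1) e0); first exact: GL2_col_mxC.
  by rewrite -/e0 act_pointE row_col_mx.
- by exists e0, e1.
- by exists e0, (e0 + e1).
- by exists e1, (e0 + e1).
Qed.

Lemma row_scalar s : (e0 *m s%:M = s *: e0) * (e1 *m s%:M = s *: e1).
Proof.
split; rewrite -rowE; apply/rowP=> j; rewrite !mxE eqxx /=.
all: case: eqP => [<-|/eqP]; rewrite ?mulr1 // => /negbTE.
all: by rewrite eq_sym => ->; rewrite mulr0.
Qed.

(** The rows of g are a (1,0), b (0,1), and their sum is s (1,1), so a = b = s. *)
Lemma fix_triple_scalar g : GL2 [set: R] g -> act_point p0 g = p0 ->
  act_point q0 g = q0 -> act_point r0 g = r0 ->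
  exists2 s, units [set: R] s & g = s%:M.
Proof.
move=> G; rewrite /p0 /q0 /r0 !act_pointE mulmxDl.
have G01 : GL2 [set: R] (col_mx e0 e1) by rewrite col_mx_e0e1; apply: GL2_1.
have G02 := GL2_sum_row G01.
have [c0 c1] := cancellable_GL2 G01; have [_ c2] := cancellable_GL2 G02.
move=> /esym/point_eq-/(_ c0 (cancellable_mul G c0))[a [ua E0]].
move=> /esym/point_eq-/(_ c1 (cancellable_mul G c1))[b [ub E1]].
rewrite -mulmxDl;
  move=> /esym/point_eq-/(_ c2 (cancellable_mul G c2))[s [us E2]].
have [E02 E12] : a = s /\ b = s.
  by apply: (GL2_col_mx_inj G01); rewrite -E0 -E1 -mulmxDl E2 scalerDr.
by exists s => //; apply: mx_eq_e0e1; rewrite ?E0 ?E1 ?E02 ?E12 row_scalar.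
Qed.

(** * The standard chain *)

Lemma subfield_subring K : is_subfield K -> is_subring K.
Proof. by case. Qed.

Lemma subfield_unit K x : is_subfield K -> K x -> x != 0 -> units K x.
Proof. by case=> _ _ _ KV Kx /(KV _ Kx)[]. Qed.

Lemma units_neq0 S x : units S x -> x != 0.
Proof. by case=> ux _ _; apply: contraTneq ux => ->; rewrite unitr0. Qed.

(** Gaussian elimination over K puts both unit vectors in the left K-span of the
    rows u, v. The coefficients make up a left inverse over K, which is then the
    inverse over R. *)
Lemma GL2_subfield_pivot K u v : is_subfield K -> mx_over K u -> mx_over K v ->
  u 0 0 != 0 -> GL2 [set: R] (col_mx u v) -> GL2 K (col_mx u v).
Proof.
move=> hK Ku Kv a_neq0 G; have hS := subfield_subring hK.
have Kg := mx_over_col_mx Ku Kv; case: (hS) => K1 _ KM.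
pose span w :=
  exists2 x : 'rV[R]_2, mx_over K x & x *m (col_mx u v : 'M[R]_2) = w.
have spanL a b w w' : K a -> K b -> span w -> span w' ->
  span (a *: w + b *: w').
  move=> Ka Kb [x Kx <-] [y Ky <-]; exists (a *: x + b *: y).
    exact: mx_over_lincomb.
  by rewrite mulmxDl !scalemxAl.
have su : span u by exists e0; rewrite ?row_col_mx //; apply: mx_over_e0.
have sv : span v by exists e1; rewrite ?row_col_mx //; apply: mx_over_e1.
have [ua _ KaV] := subfield_unit hK (Ku 0 0) a_neq0.
(* Subtracting a multiple of u clears the first entry of v and leaves s e1. *)
pose k := - (v 0 0 * (u 0 0)^-1); pose s := k * u 0 1 + v 0 1.
have Kk : K k by apply: subringN => //; apply: KM.
have vE : k *: u + 1 *: v = s *: e1.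
  rewrite [u in LHS]rV2E [v in LHS]rV2E scale1r scalerDr
    !scalerA addrACA -!scalerDl.
  by rewrite mulNr mulrVK // addNr scale0r add0r.
have Ks : K s by apply: subringD => //; apply: KM.
have s_neq0 : s != 0.
  apply/eqP=> s0; have : k *: u + 1 *: v = 0 *: u + 0 *: v.
    by rewrite vE s0 !scale0r addr0.
  by move=> /(GL2_col_mx_inj G)[_ /eqP]; rewrite oner_eq0.
have [us _ KsV] := subfield_unit hK Ks s_neq0.
have se1 : span e1.
  have := spanL s^-1 0 _ _ KsV (subring0 hS) (spanL _ _ _ _ Kk K1 su sv) su.
  by rewrite vE scalerA mulVr // scale0r scale1r addr0.
have se0 : span e0.
  have Kb : K (- ((u 0 0)^-1 * u 0 1)) by apply: subringN => //; apply: KM.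
  have := spanL _ _ _ _ KaV Kb su se1.
  rewrite [X in _ *: X + _]rV2E scalerDr !scalerA mulVr // scale1r scaleNr.
  by rewrite addrK.
case: se0 se1 => [x Kx xE] [y Ky yE]; case: (G) => _ [h [_ gh hg]].
(* The rows x, y express e0, e1 by u, v, so (x ; y) (u ; v) = 1. *)
have hE : h = col_mx x y.
  rewrite -[RHS]mulmx1 -gh mulmxA (@mul_col_mx R 1 1 2 2) xE yE.
  by rewrite col_mx_e0e1 mul1mx.
by split=> //; exists h; split=> //; rewrite hE; apply: mx_over_col_mx.
Qed.

Lemma subfield_reflects_GL2 K : is_subfield K -> reflects_GL2 K.
Proof.
move=> hK g Kg G; have hS := subfield_subring hK.
have Ku : mx_over K (e0 *m g) by apply: mx_overM => //; apply: mx_over_e0.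
have Kv : mx_over K (e1 *m g) by apply: mx_overM => //; apply: mx_over_e1.
rewrite -(col_mx_row2 g) in G *.
have [a0|a_neq0] := eqVneq ((e0 *m g) 0 0) 0; last first.
  exact: GL2_subfield_pivot.
(* If both entries of the first column vanish, e0 is not in the row space. *)
have [c0|c_neq0] := eqVneq ((e1 *m g) 0 0) 0.
  have [x [y [_ _]]] := GL2_col_mx_span subring_setT G
    (fun _ _ => I : [set: R] (e0 _ _)).
  move/rowP/(_ 0)/eqP;
    rewrite mxE [X in _ == X]mxE [X in _ == X + _]mxE [X in _ == _ + X]mxE.
  by rewrite a0 c0 !mulr0 addr0 oner_eq0.
by apply: GL2_col_mxC => //; apply: GL2_subfield_pivot => //;
  apply: GL2_col_mxC.
Qed.

Lemma cyclic_submod_point S v w : S 1 ->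
  cyclic_submod S v = cyclic_submod S w ->
  point v = point w.
Proof.
move=> S1 E.
have [a _ vE] : cyclic_submod S w v by rewrite -E; apply: cyclic_submod_id.
have [b _ wE] : cyclic_submod S v w by rewrite E; apply: cyclic_submod_id.
apply/seteqP; split=> _ [x _ <-].
  by exists (x * a) => //; rewrite -scalerA vE.
by exists (x * b) => //; rewrite -scalerA wE.
Qed.

(** This form of the standard chain makes its invariance under GL_2(K) a matter
    of group theory, and attaches to each of its points a generator that is a row
    of an invertible matrix. *)
Lemma standard_chain_orbit K : is_subring K ->
  standard_chain K = [set act_point p0 g | g in GL2 K].
Proof.
move=> hS; have K1 : K 1 by case: hS.
apply/seteqP; split=> [_ [v [Kv [g G E]] <-]|_ [g G <-]].
  exists g => //; rewrite act_pointE; apply: (cyclic_submod_point K1).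
  by rewrite -act_cyclic_submod.
exists (e0 *m g); last by rewrite act_pointE.
split; first by apply: mx_overM => //; [apply: mx_over_e0 | case: G].
by exists g; rewrite // act_cyclic_submod.
Qed.

Definition act_chain D g : set (set 'rV[R]_2) := [set act_point p g | p in D].

Lemma act_chainM D g h : act_chain (act_chain D g) h = act_chain D (g *m h).
Proof.
by rewrite /act_chain image_comp; apply: eq_imagel => p _ /=;
  rewrite act_pointM.
Qed.

Lemma act_chain1 D : act_chain D 1%:M = D.
Proof.
rewrite /act_chain -[RHS]image_id; apply: eq_imagel => p _ /=.
by rewrite act_point1.
Qed.

Lemma act_chainK D g h : g *m h = 1%:M -> act_chain (act_chain D g) h = D.
Proof. by rewrite act_chainM => ->; rewrite act_chain1. Qed.

Lemma act_chainS D D' g : D `<=` D' -> act_chain D g `<=` act_chain D' g.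
Proof. exact: image_subset. Qed.

(** Inclusions for a transformation and for its inverse give equality; with
    [conj_set_id] below, this reduces the stabilizer of C to an inclusion. *)
Lemma act_chain_id D g h : g *m h = 1%:M -> h *m g = 1%:M ->
  act_chain D g `<=` D -> act_chain D h `<=` D -> act_chain D g = D.
Proof.
move=> gh hg Dg Dh; apply/seteqP; split=> //.
by rewrite -[X in X `<=` _](act_chainK D hg); apply: act_chainS.
Qed.

Lemma standard_chain_GL2 K g : is_subring K -> GL2 K g ->
  act_chain (standard_chain K) g = standard_chain K.
Proof.
move=> hS G; have [h [H gh hg]] := GL2_inv G; rewrite standard_chain_orbit //.
have sub k : GL2 K k -> act_chain [set act_point p0 g | g in GL2 K] k `<=`
    [set act_point p0 g | g in GL2 K].
  by move=> Hk _ [_ [l Hl <-] <-]; exists (l *m k);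
    [apply: GL2M | rewrite act_pointM].
by apply: (act_chain_id gh hg); apply: sub.
Qed.

Lemma standard_chain_row K g : is_subring K -> GL2 K g ->
  standard_chain K (point (e0 *m g)).
Proof.
by move=> hS G; rewrite standard_chain_orbit //; exists g;
  rewrite // act_pointE.
Qed.

Lemma standard_chain_col_mx K u v : is_subring K -> GL2 K (col_mx u v) ->
  standard_chain K (point u).
Proof. by move=> hS /(standard_chain_row hS); rewrite row_col_mx. Qed.

Lemma standard_chain_affine K k : is_subring K -> K k ->
  standard_chain K (point (e0 + k *: e1)).
Proof.
move=> hS Kk; apply: (@standard_chain_col_mx _ _ e1) => //;
  apply: GL2_col_mxC => //.
rewrite addrC; apply: GL2_add_row => //; apply: GL2_col_mxC => //.
by rewrite col_mx_e0e1; apply: GL2_1.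
Qed.

Lemma standard_chain_triple K : is_subring K ->
  [/\ standard_chain K p0, standard_chain K q0 & standard_chain K r0].
Proof.
move=> hS; have G01 : GL2 K (col_mx e0 e1) by rewrite col_mx_e0e1; apply: GL2_1.
split.
- exact: standard_chain_col_mx G01.
- by apply: standard_chain_col_mx (GL2_col_mxC hS G01).
- by rewrite /r0 -[e1]scale1r; apply: standard_chain_affine => //; case: hS.
Qed.

(** * Scalar matrices and the normalizer *)

Lemma units1 : units [set: R] 1.
Proof. by split=> //; apply: unitr1. Qed.

Lemma units_inv s : units [set: R] s -> units [set: R] s^-1.
Proof. by move=> [us _ _]; split=> //; rewrite unitrV. Qed.

Lemma units_mul s t :
  units [set: R] s -> units [set: R] t -> units [set: R] (s * t).
Proof. by move=> [us _ _] [ut _ _]; split=> //; rewrite rpredM. Qed.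

Lemma scalar_mulV s : units [set: R] s ->
  (s%:M *m s^-1%:M = 1%:M :> 'M[R]_2) * (s^-1%:M *m s%:M = 1%:M :> 'M[R]_2).
Proof. by move=> [us _ _]; rewrite -!scalar_mxM divrr // mulVr. Qed.

Lemma conj_set_id (A : set R) s : units [set: R] s ->
  conj_set s A `<=` A -> conj_set s^-1 A `<=` A -> conj_set s A = A.
Proof.
move=> [us _ _] sA sVA; apply/seteqP; split=> // x Ax.
exists (s * x * s^-1); last by rewrite !mulrA mulVr // mul1r mulrVK.
by apply: sVA; exists x; rewrite ?invrK.
Qed.

Lemma conj_setVS (A : set R) s : units [set: R] s ->
  conj_set s A = A -> conj_set s^-1 A `<=` A.
Proof.
move=> [us _ _] sA _ [x Ax <-]; move: Ax; rewrite -{1}sA => -[y Ay <-].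
by rewrite invrK !mulrA divrr // mul1r mulrK.
Qed.

Lemma conj_mxE s g i j : (s^-1%:M *m g *m s%:M) i j = s^-1 * g i j * s.
Proof.
rewrite mul_scalar_mx mxE (bigD1 j) //= big1 ?addr0 => [|k /negbTE kj].
  by rewrite !mxE eqxx mulr1n.
by rewrite !mxE kj mulr0.
Qed.

(** R(1,k) is sent to R(s, k s) = R(1, s^-1 k s), and R(1,x) is on C only if x
    is in K. Conversely, s I fixes p0, so that p0^(g s) = p0^(s^-1 g s), and
    s^-1 g s is in GL_2(K) when conjugation by s maps K into itself. *)
Lemma standard_chain_scalar_sub K s : is_subfield K -> units [set: R] s ->
  act_chain (standard_chain K) s%:M `<=` standard_chain K <-> conj_set s K `<=` K.
Proof.
move=> hK us; have hS := subfield_subring hK; split.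
  move=> sC _ [k Kk <-]; set k' := s^-1 * k * s.
  have : standard_chain K (point (e0 + k' *: e1)).
    apply: sC; exists (point (e0 + k *: e1));
      first exact: standard_chain_affine.
    rewrite act_pointE mulmxDl -scalemxAl !row_scalar scalerA.
    have -> : k * s = s * k' by rewrite /k' !mulrA divrr ?mul1r //; case: us.
    by rewrite -scalerA -scalerDr point_scale.
  rewrite standard_chain_orbit // => -[g G]; rewrite act_pointE => E.
  have cg := cancellable_mul (GL2_setT G) cancellable_e0.
  have ck : cancellable (e0 + k' *: e1).
    by move=> x /rowP/(_ 0); rewrite !mxE /= mulr0 addr0 mulr1.
  (* A row w over K spans the same point, so w = a (1, k'): the entries a and
     a k' are in K, and hence k' is. *)
  have [a [ua wE]] := point_eq ck cg (esym E).
  have Kw : mx_over K (e0 *m g).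
    by apply: mx_overM; [| apply: mx_over_e0 | case: G].
  have Ka : K a by have := Kw 0 0; rewrite wE !mxE /= mulr0 addr0 mulr1.
  have Kak : K (a * k') by have := Kw 0 1; rewrite wE !mxE /= add0r mulr1.
  have [_ _ KaV] := subfield_unit hK Ka (units_neq0 ua).
  rewrite -[k'](mulKr (x := a)); last by case: ua.
  by case: hS => _ _; apply.
move=> sK p [q];
  rewrite !standard_chain_orbit // => -[g [Kg [h [Kh gh hg]]] <-] <-.
have [sV Vs] := scalar_mulV us.
exists (s^-1%:M *m g *m s%:M).
  split=> [i j|]; first by rewrite conj_mxE; apply: sK; exists (g i j).
  exists (s^-1%:M *m h *m s%:M); split.
  - by move=> i j; rewrite conj_mxE; apply: sK; exists (h i j).
  - by rewrite -!mulmxA (mulmxA s%:M) sV mul1mx (mulmxA g) gh mul1mx.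
  - by rewrite -!mulmxA (mulmxA s%:M) sV mul1mx (mulmxA h) hg mul1mx.
rewrite act_pointM -!mulmxA -act_pointM; congr (act_point _ _).
by rewrite act_pointE row_scalar point_scale //; apply: units_inv.
Qed.

Lemma standard_chain_scalar K s : is_subfield K -> units [set: R] s ->
  act_chain (standard_chain K) s%:M = standard_chain K <-> normalizer K s.
Proof.
move=> hK us; have [sV Vs] := scalar_mulV us; have usV := units_inv us.
split=> [E | [_ E]].
  split=> //; apply: conj_set_id => //; apply/standard_chain_scalar_sub => //.
    by rewrite E.
  by rewrite -[X in act_chain X _]E act_chainM sV act_chain1.
apply: (act_chain_id sV Vs); apply/standard_chain_scalar_sub => //.
  by rewrite E.
exact: conj_setVS.
Qed.

Lemma standard_chain_scalar_eq K s t : is_subfield K ->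
  units [set: R] s -> units [set: R] t ->
  act_chain (standard_chain K) s%:M = act_chain (standard_chain K) t%:M <->
  normalizer K (s * t^-1).
Proof.
move=> hK us ut; have [tV Vt] := scalar_mulV ut.
rewrite -standard_chain_scalar //; last by apply: units_mul => //;
  apply: units_inv.
rewrite scalar_mxM -act_chainM; split=> [->|E]; first exact: act_chainK.
by rewrite -[in RHS]E act_chainM Vt act_chain1.
Qed.

(** * Chains through a triple *)

(** The points of C mapped by g to p0, q0, r0 are pairwise distant and have
    generators over K, so some k in GL_2(K) maps p0, q0, r0 to them; then k g
    fixes the triple and C^g = C^(k g). *)
Lemma chain_through_std K g : is_subfield K -> GL2 [set: R] g ->
  act_chain (standard_chain K) g p0 -> act_chain (standard_chain K) g q0 ->
  act_chain (standard_chain K) g r0 ->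
  exists2 s, units [set: R] s &
    act_chain (standard_chain K) g = act_chain (standard_chain K) s%:M.
Proof.
move=> hK G; have hS := subfield_subring hK; have [h [H gh hg]] := GL2_inv G.
have pull p : act_chain (standard_chain K) g p ->
    exists u, [/\ mx_over K u, cancellable u, p = act_point (point u) g &
      point u = act_point p h].
  move=> [q]; rewrite standard_chain_orbit // => -[k Gk <-] <-.
  exists (e0 *m k); split; rewrite ?act_pointE //.
  - by apply: mx_overM => //; [apply: mx_over_e0 | case: Gk].
  - by apply: cancellable_mul; [apply: GL2_setT Gk | apply: cancellable_e0].
  - by rewrite -!mulmxA gh mulmx1.
move=> /pull[u [Ku cu pE uE]] /pull[v [Kv cv qE vE]] /pull[w [Kw cw rE wE]].
have [_ [dpq dpr dqr]] := std_distant_triple.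
have Guv : GL2 [set: R] (col_mx u v).
  by apply: distant_GL2 => //; rewrite uE vE; apply: distant_act.
have Guw : GL2 [set: R] (col_mx u w).
  by apply: distant_GL2 => //; rewrite uE wE; apply: distant_act.
have Gvw : GL2 [set: R] (col_mx v w).
  by apply: distant_GL2 => //; rewrite vE wE; apply: distant_act.
have [k [Gk pk qk rk]] :=
  distant_rows_frame hS (subfield_reflects_GL2 hK) Ku Kv Kw Guv Guw Gvw.
have [||||s us kgE] := @fix_triple_scalar (k *m g).
- by apply: GL2M => //; apply: GL2_setT Gk.
- by rewrite -act_pointM pk.
- by rewrite -act_pointM qk.
- by rewrite -act_pointM rk.
exists s => //; rewrite -kgE -act_chainM; congr act_chain.
by rewrite standard_chain_GL2.
Qed.

Lemma chains_through_frame K p q r f : is_subfield K -> GL2 [set: R] f ->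
  act_point p0 f = p -> act_point q0 f = q -> act_point r0 f = r ->
  chains_through K p q r =
  [set act_chain (standard_chain K) (s%:M *m f) | s in units [set: R]].
Proof.
move=> hK Gf <- <- <-; have hS := subfield_subring hK.
have [f' [Gf' ff' f'f]] := GL2_inv Gf.
apply/seteqP; split=> [D [[g G <-] [Dp Dq Dr]]|_ [s us <-]].
  have pull x : act_chain (standard_chain K) g (act_point x f) ->
      act_chain (standard_chain K) (g *m f') x.
    move=> Dx; rewrite -act_chainM; exists (act_point x f) => //.
    by rewrite act_pointM ff' act_point1.
  have [s us E] := chain_through_std hK (GL2M subring_setT G Gf')
    (pull _ Dp) (pull _ Dq) (pull _ Dr).
  by exists s => //; rewrite -act_chainM -E act_chainM -mulmxA f'f mulmx1.
have [Cp Cq Cr] := standard_chain_triple hS.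
split.
  by exists (s%:M *m f) => //; apply: GL2M => //; apply: GL2_scalar.
have fix_p x : act_point x s%:M = x -> standard_chain K x ->
    act_chain (standard_chain K) (s%:M *m f) (act_point x f).
  by move=> xs Cx; exists x => //; rewrite -act_pointM xs.
split; apply: fix_p => //;
  rewrite act_pointE ?mulmxDl !row_scalar -?scalerDr point_scale //.
Qed.

(** For f a frame of the triple, this is the coset that corresponds to D. *)
Definition scalars_of_chain K f D : set R :=
  [set s | units [set: R] s /\ act_chain (standard_chain K) (s%:M *m f) = D].

Lemma scalars_of_chain_coset K f t : is_subfield K -> GL2 [set: R] f ->
  units [set: R] t ->
  scalars_of_chain K f (act_chain (standard_chain K) (t%:M *m f)) =
  [set n * t | n in normalizer K].
Proof.
move=> hK Gf ut; have [f' [_ ff' f'f]] := GL2_inv Gf.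
have cancel s : act_chain (standard_chain K) (s%:M *m f) =
    act_chain (standard_chain K) (t%:M *m f) <->
    act_chain (standard_chain K) s%:M = act_chain (standard_chain K) t%:M.
  rewrite -!act_chainM; split=> [E|-> //].
  by rewrite -[LHS](act_chainK _ ff') E act_chainK.
apply/seteqP; split=> [s [us /cancel/standard_chain_scalar_eq E]|_ [n nN <-]].
  exists (s * t^-1); first exact: E.
  by rewrite mulrVK //; case: ut.
have unt : units [set: R] (n * t) by apply: units_mul => //; case: nN.
split=> //; apply/cancel/standard_chain_scalar_eq => //.
by rewrite mulrK //; case: ut.
Qed.

Lemma chains_through_card K p q r : is_subfield K -> distant_triple p q r ->
  (chains_through K p q r #= right_cosets (normalizer K) (units [set: R]))%card.
Proof.
move=> hK /distant_triple_frame[f [Gf Ep Eq Er]].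
rewrite (chains_through_frame hK Gf Ep Eq Er).
set C := image _ _; rewrite card_eq_sym.
have -> : right_cosets (normalizer K) (units [set: R]) =
    scalars_of_chain K f @` C.
  rewrite /C image_comp; apply: eq_imagel => t ut /=.
  by rewrite scalars_of_chain_coset.
(* Every chain through the triple has a nonempty set of scalars, and a scalar
   determines its chain. *)
apply: inj_card_eq => D D' /set_mem[t ut <-] _ E.
have : scalars_of_chain K f (act_chain (standard_chain K) (t%:M *m f)) t by [].
by rewrite E => -[].
Qed.

(** Conjugation fixes 0, so it makes no difference whether K or K^* is
    preserved. *)
Lemma normal_units_iff K : is_subfield K ->
  normal_in (units K) (units [set: R]) <->
  forall s, units [set: R] s -> normalizer K s.
Proof.
move=> hK; have hS := subfield_subring hK; split=> [[_ nK] s us|nK].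
  suff sub t : units [set: R] t -> conj_set t K `<=` K.
    by split=> //; apply: conj_set_id => //; apply: sub => //; apply: units_inv.
  move=> ut _ [k Kk <-]; have [->|k_neq0] := eqVneq k 0.
    by rewrite mulr0 mul0r; apply: subring0.
  suff [] : units K (t^-1 * k * t) by [].
  by rewrite -(nK t ut); exists k => //; apply: subfield_unit.
split=> [k [uk _ _] //|s us].
suff sub t : units [set: R] t -> conj_set t (units K) `<=` units K.
  by apply: conj_set_id => //; apply: sub => //; apply: units_inv.
move=> ut _ [k Hk <-]; have [_ tK] := nK t ut.
apply: subfield_unit => //; first by rewrite -tK; exists k => //; case: Hk.
apply: (@units_neq0 [set: R]); apply: units_mul => //; apply: units_mul.
  exact: units_inv.
by case: Hk => uk _ _.
Qed.

End ChainsThroughATriple.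

Theorem theorem2p4 (R : unitRingType) (K : set R) (hK : is_subfield K) :
  (forall p q r : set 'rV[R]_2, distant_triple p q r ->
     (chains_through K p q r #=
       right_cosets (normalizer K) (units [set: R]))%card) /\
  ((forall p q r : set 'rV[R]_2, distant_triple p q r ->
      exists! D, chains_through K p q r D) <->
   normal_in (units K) (units [set: R])).
Proof.
split=> [p q r|]; first exact: chains_through_card.
rewrite normal_units_iff //; split=> [uniq s us | nK p q r].
  have [D [_ D_uniq]] := uniq _ _ _ (std_distant_triple R).
  move: D_uniq;
    rewrite (chains_through_frame hK (GL2_1 (subring_setT R)) (act_point1 _)
    (act_point1 _) (act_point1 _)).
  move=> D_uniq; apply/standard_chain_scalar => //.
  rewrite -[RHS]act_chain1.
  have := D_uniq _ (imageP _ us); rewrite (D_uniq _ (imageP _ (units1 R))).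
  by rewrite !mulmx1.
move=> /distant_triple_frame[f [Gf Ep Eq Er]].
rewrite (chains_through_frame hK Gf Ep Eq Er).
exists (act_chain (standard_chain K) f); split.
  by exists 1; [apply: units1 | rewrite mul1mx].
move=> _ [s us <-]; rewrite -act_chainM.
by congr act_chain; apply/esym/standard_chain_scalar => //; apply: nK.
Qed.
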